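(* Let $\mathcal{H}$ be an $n$-dimensional Hilbert space and let $F=\{f_j\}_{j=1}^N\in\mathcal{H}^N$ be a frame for $\mathcal{H}$ with the full spark property. Then the set $$\mathcal{G}:=\{G\in F^*:(F,G)\text{ has the full skew spark property}\}$$ is generic in $F^*$, i.e. it is open and dense in $F^*$ with respect to the relative topology inherited from $\mathcal{H}^N$.
   Context: $\mathcal{H}^N$ is the space of $N$-tuples of vectors in the $n$-dimensional (complex) Hilbert space $\mathcal{H}$, with norm $\|F\|:=\max_{1\le j\le N}\|f_j\|$. A frame in $\mathcal{H}^N$ is an $N$-tuple that spans $\mathcal{H}$. $(F,G)$ with $F=\{f_j\}_{j=1}^N$, $G=\{g_j\}_{j=1}^N$ is a dual frame pair if $f=\sum_{j=1}^N\langle f,g_j\rangle f_j$ for all $f\in\mathcal{H}$, and the dual set of $F$ is $F^*=\{G\in\mathcal{H}^N:(F,G)\text{ is a dual frame pair}\}$. $F$ has spark $k$ if every collection of $k$ vectors of $F$ (i.e. $\{f_j\}_{j\in S}$ with $|S|=k$) is linearly independent; $F$ has the full spark property if it has spark $n$. For $\Lambda,\Omega\subset\{1,\dots,N\}$, $B(F,G,\Lambda,\Omega)=(\langle f_j,g_k\rangle)_{j\in\Lambda,\,k\in\Omega}$ (rows indexed by $\Lambda$, columns by $\Omega$). A dual frame pair $(F,G)$ has skew spark $k$ if for every $\Lambda\subset\{1,\dots,N\}$ with $|\Lambda|\le k$ and every $\Omega\subset\{1,\dots,N\}\setminus\Lambda$ with $|\Omega|=|\Lambda|$, the matrix $B(F,G,\Lambda,\Omega)$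 is invertible. It has the full skew spark property if it has skew spark $\min\{\frac N2,n,N-n\}$. *)

(* Defs.v *)
From HB Require Import structures.
From mathcomp Require Import all_boot all_order all_algebra.
From mathcomp Require Import all_classical all_reals all_analysis.
From mathcomp Require Export complex.

Set Implicit Arguments.
Unset Strict Implicit.
Unset Printing Implicit Defensive.

Import Order.TTheory GRing.Theory Num.Theory Num.Def.

Local Open Scope classical_set_scope.
Local Open Scope ring_scope.

(* A finite-dimensional complex Hilbert space is rendered as a vectType H over
   a numClosedFieldType C (to be instantiated with R[i] for R : realType),
   together with a positive definite Hermitian form dot, linear in its first
   argument and conjugate linear in its second one. *)

(* The space H^N. The form dot is a parameter because the topology declared
   below is the one of the norm that dot induces. *)
Definition htuple (C : numClosedFieldType) (H : vectType C)
  (dot : {dot H for conjC}) (N : nat) : Type := {ffun 'I_N -> H}.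

Definition htuple_fun (C : numClosedFieldType) (H : vectType C)
  (dot : {dot H for conjC}) (N : nat) (F : htuple dot N) : 'I_N -> H :=
  fun_of_fin (F : {ffun 'I_N -> H}).

Coercion htuple_fun : htuple >-> Funclass.

Section TupleSpace.
Variables (C : numClosedFieldType) (H : vectType C) (dot : {dot H for conjC}).

Local Notation htuple := (htuple dot).

Definition hnorm (x : H) : C := sqrtC (dot x x).

(* The max is taken in C, where the order is only partial; the norms are
   nonnegative, hence pairwise comparable. *)
Definition htuple_norm (N : nat) (F : htuple N) : C :=
  \big[Num.max/0]_(j < N) hnorm (F j).

HB.instance Definition _ (N : nat) := GRing.Lmodule.on (htuple N).

Lemma htuple_norm_ge0 (N : nat) (F : htuple N) : 0 <= htuple_norm F.
Proof.
rewrite /htuple_norm; elim/big_ind: _ => // [x y x0 y0|i _].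
  by rewrite /Num.max; case: ifP.
exact: sqrt_dnorm_ge0.
Qed.

Lemma htuple_norm_ub (N : nat) (F : htuple N) (j : 'I_N) :
  hnorm (F j) <= htuple_norm F.
Proof.
have h0 i : 0 <= hnorm (F i) by exact: sqrt_dnorm_ge0.
rewrite /htuple_norm.
have : j \in index_enum 'I_N by rewrite mem_index_enum.
elim: (index_enum _) => // i s IH; rewrite inE big_cons => js.
set M := \big[_/_]_(_ <- _) _ in IH *.
have M0 : 0 <= M.
  rewrite /M; elim/big_ind: _ => // x y x0 y0; by rewrite /Num.max; case: ifP.
have cmp : hnorm (F i) >=< M by rewrite real_comparable ?ger0_real.
rewrite comparable_le_max //.
by case/orP: js => [/eqP <-|/IH ->]; rewrite ?lexx ?orbT.
Qed.

Lemma htuple_norm_le (N : nat) (F : htuple N) (c : C) :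
  0 <= c -> (forall j, hnorm (F j) <= c) -> htuple_norm F <= c.
Proof.
move=> c0 Fc; rewrite /htuple_norm; elim/big_ind: _ => // x y xc yc.
by rewrite /Num.max; case: ifP.
Qed.

Lemma ler_htuple_normD (N : nat) (F G : htuple N) :
  htuple_norm (F + G) <= htuple_norm F + htuple_norm G.
Proof.
apply: htuple_norm_le => [|j]; first by rewrite addr_ge0 ?htuple_norm_ge0.
apply: le_trans (lerD (htuple_norm_ub F j) (htuple_norm_ub G j)).
by rewrite /htuple_fun ffunE; exact: triangle_lerif.
Qed.

Lemma hnormZ (a : C) (x : H) : hnorm (a *: x) = `|a| * hnorm x.
Proof.
by rewrite /hnorm dnormZ sqrtCM ?nnegrE ?exprn_ge0 ?dnorm_ge0 // sqrCK.
Qed.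

Lemma htuple_normZ (N : nat) (a : C) (F : htuple N) :
  htuple_norm (a *: F) = `|a| * htuple_norm F.
Proof.
have ub (b : C) (G : htuple N) : htuple_norm (b *: G) <= `|b| * htuple_norm G.
  apply: htuple_norm_le => [|j]; first by rewrite mulr_ge0 ?htuple_norm_ge0.
  by rewrite /htuple_fun ffunE hnormZ ler_wpM2l ?htuple_norm_ub.
apply/eqP; rewrite eq_le ub /=.
have [->|a0] := eqVneq a 0; first by rewrite normr0 mul0r htuple_norm_ge0.
have := ub a^-1 (a *: F).
by rewrite scalerA mulVf // scale1r normfV mulrC ler_pdivlMr ?normr_gt0 // mulrC.
Qed.

Lemma htuple_norm0_eq0 (N : nat) (F : htuple N) : htuple_norm F = 0 -> F = 0.
Proof.
move=> F0; apply/ffunP => j; rewrite ffunE; apply/eqP.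
rewrite -(sqrt_dnorm_eq0 dot) eq_le sqrt_dnorm_ge0 andbT -F0.
exact: htuple_norm_ub.
Qed.

HB.instance Definition _ (N : nat) := Lmodule_isNormed.Build C (htuple N)
  (@ler_htuple_normD N) (@htuple_normZ N) (@htuple_norm0_eq0 N).

End TupleSpace.

Section Frames.
Variables (C : numClosedFieldType) (H : vectType C) (dot : {dot H for conjC}).
Variable N : nat.
Implicit Types F G : htuple dot N.

Definition is_frame F : Prop := <<[seq F j | j : 'I_N]>>%VS = fullv.

(* free concerns indexed families: a repeated vector is a dependence. *)
Definition has_spark F (k : nat) : Prop :=
  forall S : {set 'I_N}, #|S| = k -> free [seq F j | j in S].

Definition full_spark F : Prop := has_spark F (\dim {:H}).

Definition dual_pair F G : Prop :=
  forall f : H, f = \sum_(j < N) dot f (G j) *: F j.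

Definition dual_set F : set (htuple dot N) := [set G | dual_pair F G].

(* Rows and columns are listed in increasing order of the indices. *)
Definition skew_gram F G (L O : {set 'I_N}) : 'M[C]_(#|L|, #|O|) :=
  \matrix_(i, j) dot (F (enum_val i)) (G (enum_val j)).

(* The bound k is rational since it is to be instantiated with a minimum that
   involves N / 2. *)
Definition has_skew_spark F G (k : rat) : Prop :=
  forall (L O : {set 'I_N}) (eqLO : #|O| = #|L|),
    #|L|%:R <= k -> O \subset ~: L ->
    castmx (erefl #|L|, eqLO) (skew_gram F G L O) \in unitmx.

Definition full_skew_spark F G : Prop :=
  has_skew_spark F G
    (Num.min (N%:R / 2%:R)
             (Num.min (\dim {:H})%:R (N%:R - (\dim {:H})%:R))).

End Frames.

(* Inside this definition A is also the subtype of T with carrier A, with the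
   topology inherited from T. *)
Definition generic_in (T : topologicalType) (A B : set T) : Prop :=
  [/\ B `<=` A, open (set_val @^-1` B : set A) & dense (set_val @^-1` B : set A)].

(* Main.v *)
Require Import Defs.
From mathcomp Require Import all_boot all_order all_algebra.
From mathcomp Require Import all_classical all_reals all_analysis.
Import Num.Def.
Import Order.TTheory GRing.Theory Num.Theory.
Import numFieldNormedType.Exports.
Set Implicit Arguments.
Unset Strict Implicit.
Unset Printing Implicit Defensive.
Local Open Scope classical_set_scope.
Local Open Scope ring_scope.
Local Open Scope complex_scope.

(** The theorem says that finitely many minors of the cross Gram matrix of
    [F] and [G] are nonzero for generic dual frames [G]: one minor for each
    pair of disjoint index sets [L], [O] of a common size k, where k <= n and
    k <= N - n, n being the dimension of the space.

    A finite intersection of dense open sets is dense and open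
    ([open_dense_bigcap]), so one minor can be treated at a time.  It depends
    continuously on [G], hence the set where it does not vanish is open
    ([open_skew_minor]).  For the density, let [G] be any dual of [F], and
    suppose that the minor does not vanish at some dual [G1].  The dual set
    is affine, so it contains the line through [G] and [G1]; along the real
    points of this line the minor is a polynomial in the parameter, nonzero
    at the parameter of [G1].  It has finitely many roots, so the minor is
    nonzero at points of the line arbitrarily close to [G]
    ([small_unitmx], [dense_skew_minor]).

    What remains is to find [G1] for given [L] and [O]
    ([exists_dual_unitmx]).  Since k <= n <= N - k, some index set [J] of
    size n contains [O] and avoids [L].  By full spark, the vectors of [F]
    with index in [J] form a basis; let [G1] be its dual basis on [J] and
    zero elsewhere.  If the rows of the minor satisfy a linear relation with
    coefficients [u], the vector f = \sum_(l in L) u l *: F l is orthogonal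
    to G1 j both for j in [O] and for j outside [J], so it is a combination
    of the vectors of [F] indexed by [J] minus [O].  The union of [L] and of
    [J] minus [O] has n elements, so full spark applies again and [u] is
    zero. *)

(** * Finite index sets and coordinates *)

Lemma subset_of_card_between (T : finType) (A B : {set T}) (n : nat) :
  A \subset B -> (#|A| <= n <= #|B|)%N ->
  exists S : {set T}, [/\ A \subset S, S \subset B & #|S| = n].
Proof.
move=> AB /andP[An nB].
pose D := enum (B :\: A)%SET.
pose E := take (n - #|A|) D.
have EP x : x \in E -> (x \in B) && (x \notin A).
  by move=> /mem_take; rewrite mem_enum inE andbC.
exists (A :|: [set:: E])%SET; split.
- exact: finset.subsetUl.
- rewrite finset.subUset AB; apply/fintype.subsetP => x.
  by rewrite inE => /EP/andP[].
- rewrite cardsU (_ : A :&: _ = finset.set0)%SET ?cards0 ?subn0.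
    rewrite cardsE (card_uniqP _) ?take_uniq ?enum_uniq // size_takel.
      exact: subnKC.
    by rewrite -cardE cardsD (finset.setIidPr AB) leq_sub2r.
  apply/setP => x; rewrite !inE; apply/negbTE/andP => -[xA /EP].
  by rewrite xA andbF.
Qed.

(** Families indexed by the positions of a set [S] arise from coordinates and
    matrices, families indexed by the ambient type from [F] and [G]; this is
    the passage from the former to the latter, by zero outside [S]. *)
Definition extend0 (V : nmodType) (I : finType) (S : {set I})
    (c : 'I_#|S| -> V) (i : I) : V :=
  \sum_(k < #|S| | enum_val k == i) c k.

Lemma extend0_enum_val (V : nmodType) (I : finType) (S : {set I})
    (c : 'I_#|S| -> V) (k : 'I_#|S|) : extend0 c (enum_val k) = c k.
Proof.
rewrite /extend0 (bigD1 k) //= big1 ?addr0 // => l /andP[/eqP/enum_val_inj ->].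
by rewrite eqxx.
Qed.

Lemma extend0_notin (V : nmodType) (I : finType) (S : {set I})
    (c : 'I_#|S| -> V) (i : I) : i \notin S -> extend0 c i = 0.
Proof.
move=> iS; rewrite /extend0 big1 // => k /eqP ki.
by rewrite -ki enum_valP in iS.
Qed.

(** The next two lemmas are coordinates in a family indexed by a set rather
    than by its positions; they let sums over different subsets of the same
    frame be combined. *)
Lemma free_imageP (K : fieldType) (V : vectType K) (I : finType)
    (v : I -> V) (S : {set I}) :
  free [seq v i | i in S] ->
  forall c : I -> K, \sum_(i in S) c i *: v i = 0 ->
  forall i, i \in S -> c i = 0.
Proof.
move=> frv c; rewrite big_enum_val /= => c0 i iS.
have sz : size [seq v i | i in S] == #|S| by rewrite size_image.
have /(@freeP _ _ _ (Tuple sz))/(_ (fun k => c (enum_val k))) := frv.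
have -> : \sum_(k < #|S|) c (enum_val k) *: (Tuple sz)`_k =
    \sum_(k < #|S|) c (enum_val k) *: v (enum_val k).
  by apply: eq_bigr => k _; rewrite /= nth_image.
by move=> /(_ c0)/(_ (enum_rank_in iS i)); rewrite enum_rankK_in.
Qed.

Lemma basis_imageP (K : fieldType) (V : vectType K) (I : finType)
    (v : I -> V) (S : {set I}) :
  free [seq v i | i in S] -> #|S| = \dim {:V} ->
  forall x, exists c : I -> K, x = \sum_(i in S) c i *: v i.
Proof.
move=> frv cS x.
have sz : size [seq v i | i in S] == #|S| by rewrite size_image.
have : basis_of fullv (Tuple sz).
  by rewrite basisEfree frv subvf /= size_image cS leqnn.
move=> /span_basis xE.
have /coord_span xS : x \in <<Tuple sz>>%VS by rewrite xE memvf.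
exists (extend0 (fun k => coord (Tuple sz) k x)); rewrite [LHS]xS.
rewrite [RHS]big_enum_val; apply: eq_bigr => k _ /=.
by rewrite nth_image extend0_enum_val.
Qed.

(** * Biorthogonal families in a Hilbert space *)

Section Biorthogonal.
Variables (C : numClosedFieldType) (H : vectType C) (dot : {dot H for conjC}).

Lemma dot_suml (I : finType) (P : pred I) (c : I -> C) (v : I -> H) (w : H) :
  dot (\sum_(i | P i) c i *: v i) w = \sum_(i | P i) c i * dot (v i) w.
Proof.
by rewrite linear_sumlz; apply: eq_bigr => i _; rewrite linearZl_LR.
Qed.

Lemma dot_sumr (I : finType) (P : pred I) (c : I -> C) (v : I -> H) (w : H) :
  dot w (\sum_(i | P i) c i *: v i) = \sum_(i | P i) conjC (c i) * dot w (v i).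
Proof.
by rewrite linear_sumr; apply: eq_bigr => i _; rewrite linearZr_LR.
Qed.

(** A row vector killed by the Gram matrix gives a combination of the vectors
    that is orthogonal to each of them, hence to itself, hence zero. *)
Lemma gram_unitmx (m : nat) (v : 'I_m -> H) :
  (forall c : 'I_m -> C, \sum_i c i *: v i = 0 -> forall i, c i = 0) ->
  \matrix_(i, j) dot (v i) (v j) \in unitmx.
Proof.
move=> frv; rewrite -row_free_unit; apply: inj_row_free => u u0.
apply/rowP => i; rewrite mxE; move: i; apply: frv.
set w := \sum_i _.
have wv j : dot w (v j) = 0.
  rewrite dot_suml; move/rowP: u0 => /(_ j); rewrite !mxE => E; rewrite -[RHS]E.
  by apply: eq_bigr => i _; rewrite mxE.
apply/eqP; rewrite -(dnorm_eq0 dot) {2}/w dot_sumr big1 // => i _.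
by rewrite wv mulr0.
Qed.

(** The biorthogonal family is obtained from [v] by the inverse of its Gram
    matrix, conjugated because the form is conjugate linear on the right. *)
Lemma biorthogonal (I : finType) (v : I -> H) (S : {set I}) :
  free [seq v i | i in S] ->
  exists g : I -> H,
    (forall i j, i \in S -> dot (v i) (g j) = (i == j)%:R) /\
    (forall j, j \notin S -> g j = 0).
Proof.
move=> frv; set M := \matrix_(i < #|S|, j < #|S|)
  dot (v (enum_val i)) (v (enum_val j)).
have Mu : M \in unitmx.
  apply: gram_unitmx => c c0 i.
  rewrite -(extend0_enum_val c) (free_imageP frv) ?enum_valP //.
  rewrite big_enum_val -[RHS]c0; apply: eq_bigr => k _.
  by rewrite extend0_enum_val.
pose g k := \sum_(l < #|S|) conjC (invmx M l k) *: v (enum_val l).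
have gE i k : dot (v (enum_val i)) (g k) = (i == k)%:R.
  have /matrixP/(_ i k) := mulmxV Mu; rewrite !mxE => E; rewrite -[RHS]E.
  rewrite dot_sumr; apply: eq_bigr => l _; rewrite conjCK mulrC.
  by rewrite mxE.
exists (extend0 g); split=> [i j iS|j]; last exact: extend0_notin.
rewrite -(enum_rankK_in iS iS); set k := enum_rank_in iS i.
have [jS|jS] := boolP (j \in S).
  rewrite -(enum_rankK_in jS jS) extend0_enum_val gE.
  by rewrite (inj_eq enum_val_inj).
rewrite extend0_notin // linear0r; case: eqP => // kj.
by rewrite -kj enum_valP in jS.
Qed.

End Biorthogonal.

(** * A dual frame for which a given minor is nonzero *)

Section Minor.
Variables (C : numClosedFieldType) (H : vectType C) (dot : {dot H for conjC}).
Variable N : nat.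
Implicit Types F G : htuple dot N.

(** Full spark is used twice: on a set [J] that contains [O] and avoids [L],
    where it provides the dual frame, and on the set obtained from [J] by
    exchanging [O] for [L], where it shows that the rows are independent. *)
Lemma exists_dual_unitmx F (L O : {set 'I_N}) (eqLO : #|O| = #|L|) :
  full_spark F -> (#|L| <= \dim {:H})%N -> (\dim {:H} + #|L| <= N)%N ->
  O \subset (~: L)%SET ->
  exists2 G, dual_pair F G &
    castmx (erefl #|L|, eqLO) (skew_gram F G L O) \in unitmx.
Proof.
move=> sparkF Ln nLN OL.
have [|J [OJ JL cJ]] := @subset_of_card_between _ _ _ (\dim {:H}) OL.
  rewrite eqLO Ln /= -(leq_add2r #|L|) [(#|(~: L)%SET| + _)%N]addnC.
  by rewrite cardsC card_ord.
have [g [gE g0]] := biorthogonal dot (sparkF J cJ).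
pose G : htuple dot N := [ffun j => g j] : {ffun 'I_N -> H}.
have GE j : G j = g j by rewrite /G /htuple_fun ffunE.
have dG : dual_pair F G.
  move=> f; have [c fE] := basis_imageP (sparkF J cJ) cJ f.
  rewrite (bigID [in J]) /= [X in _ + X]big1 ?addr0 => [|j /g0 gj]; last first.
    by rewrite GE gj linear0r scale0r.
  rewrite {1}fE; apply: eq_bigr => j jJ; congr (_ *: _).
  rewrite GE fE dot_suml (bigD1 j) //= gE // eqxx mulr1.
  rewrite big1 ?addr0 // => i /andP[iJ ij].
  by rewrite gE // (negbTE ij) mulr0.
exists G => //; rewrite -row_free_unit; apply: inj_row_free => u u0.
pose u' : 'I_N -> C := extend0 (fun k : 'I_#|L| => u 0 k).
have u'E k : u' (enum_val k) = u 0 k by exact: extend0_enum_val.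
have u'0 x : x \notin L -> u' x = 0 by exact: extend0_notin.
pose f := \sum_(j in L) u' j *: F j.
have fO o : o \in O -> dot f (G o) = 0.
  move=> oO; move/rowP: u0 => /(_ (cast_ord eqLO (enum_rank_in oO o))).
  rewrite !mxE => E; rewrite -[RHS]E dot_suml.
  rewrite [LHS]big_enum_val; apply: eq_bigr => k _.
  by rewrite u'E castmxE mxE /= cast_ord_id cast_ordK enum_rankK_in.
(* [L] is disjoint from [J] and as large as [O], so the exchange keeps n. *)
pose S := (L :|: (J :\: O))%SET.
have cS : #|S| = \dim {:H}.
  rewrite cardsU (_ : L :&: _ = finset.set0)%SET.
    by rewrite cards0 subn0 cardsD (finset.setIidPr OJ) cJ eqLO subnKC.
  apply/setP => x; rewrite !inE.
  apply/negbTE/and3P => -[xL _ /(fintype.subsetP JL)].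
  by rewrite inE xL.
(* Expanding f in the dual pair (F, G) gives a linear relation on all of [F];
   its coefficients vanish outside [S]. *)
pose c j := u' j - dot f (G j).
have c0 j : j \notin S -> c j = 0.
  rewrite !inE negb_or negb_and negbK => /andP[jL jOJ].
  rewrite /c u'0 // sub0r; apply/eqP; rewrite oppr_eq0; apply/eqP.
  by case/orP: jOJ => [/fO //|/g0 gj]; rewrite GE gj linear0r.
have cF : \sum_(j in S) c j *: F j = 0.
  have : \sum_j c j *: F j = 0.
    under eq_bigr do rewrite scalerBl.
    rewrite sumrB -dG (bigID [in L]) /= [X in _ + X - _]big1 ?addr0 ?subrr //.
    by move=> j /u'0 ->; rewrite scale0r.
  rewrite (bigID [in S]) /= [X in _ + X]big1 ?addr0 // => j /c0 ->.
  by rewrite scale0r.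
apply/rowP => k; rewrite mxE -u'E.
have kL := enum_valP k.
have := free_imageP (sparkF S cS) cF (i := enum_val k).
rewrite inE kL /c => /(_ isT) <-.
have /g0 gk : enum_val k \notin J.
  by apply/negP => /(fintype.subsetP JL); rewrite inE kL.
by rewrite GE gk linear0r subr0.
Qed.

End Minor.

(** * Nonvanishing of determinants *)

(** The points e / 2, e / 3, ... are pairwise distinct, and one more of them
    than the degree allows cannot all be roots. *)
Lemma small_nonroot (K : numFieldType) (p : {poly K}) (e : K) :
  p != 0 -> 0 < e -> exists t, [/\ 0 < t, t < e & ~~ root p t].
Proof.
move=> p0 e0; pose s := [seq e / k.+2%:R | k <- iota 0 (size p)].
have us : uniq s.
  rewrite map_inj_uniq ?iota_uniq // => k l /(mulfI (lt0r_neq0 e0))/invr_inj.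
  by move/eqP; rewrite eqr_nat eqSS eqSS => /eqP.
have /allPn[_ /mapP[k _ ->] rk] : ~~ all (root p) s.
  apply/negP => /(max_poly_roots p0)/(_ us).
  by rewrite size_map size_iota ltnn.
exists (e / k.+2%:R); split=> //; first by rewrite divr_gt0 ?ltr0n.
by rewrite ltr_pdivrMr ?ltr0n // ltr_pMr // ltr1n.
Qed.

(** The determinant along the line from [A] to [B] is a polynomial in the
    parameter, nonzero at 1. *)
Lemma small_unitmx (K : numFieldType) (n : nat) (A B : 'M[K]_n) (e : K) :
  B \in unitmx -> 0 < e ->
  exists t, [/\ 0 < t, t < e & A + t *: (B - A) \in unitmx].
Proof.
move=> Bu e0.
pose p := \det (map_mx polyC A + 'X *: map_mx polyC (B - A)).
have pE t : p.[t] = \det (A + t *: (B - A)).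
  rewrite -[LHS]/(horner_eval t p) /p -det_map_mx; congr (\det _).
  by apply/matrixP => i j; rewrite !mxE /= /horner_eval !hornerE.
have [|t [t0 te pt]] := @small_nonroot _ p e _ e0.
  (* The value of p at 1 is the determinant of B. *)
  apply: contraTneq Bu => p0; rewrite unitmxE unitfE negbK.
  by have := pE 1; rewrite p0 horner0 scale1r addrC subrK => <-.
by exists t; split => //; rewrite unitmxE unitfE -pE.
Qed.

(** * Topology of the dual set *)

Lemma open_dense_bigcap (T : topologicalType) (I : finType) (A : I -> set T) :
  (forall i, open (A i)) -> (forall i, dense (A i)) ->
  open (\bigcap_i A i) /\ dense (\bigcap_i A i).
Proof.
move=> oA dA.
rewrite (_ : \bigcap_i A i = \big[setI/setT]_(i <- enum I) A i); last first.
  by rewrite -bigcap_seq; congr bigcap; apply/seteqP; split=> i //= _;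
    rewrite mem_enum.
elim/big_rec: _ => [|i B _ [oB dB]].
  by split; [exact: openT|move=> U U0 _; rewrite setIT].
by split; [exact: openI|exact: denseI].
Qed.

Lemma continuous_det (K : numFieldType) (T : topologicalType) (n : nat)
    (M : T -> 'M[K]_n) :
  (forall i j, continuous (fun x => M x i j)) ->
  continuous (fun x => \det (M x)).
Proof.
move=> cM; rewrite /determinant; apply: continuous_big => [|s _ x].
  exact: add_continuous.
apply: cvgM; first exact: cvg_cst.
by apply: continuous_big => [|i _]; [exact: mul_continuous|exact: cM].
Qed.

Lemma open_unitmx (K : numFieldType) (T : topologicalType) (n : nat)
    (M : T -> 'M[K]_n) :
  (forall i j, continuous (fun x => M x i j)) ->
  open [set x | M x \in unitmx].
Proof.
move=> /continuous_det cM.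
rewrite (_ : [set x | _] = (fun x => \det (M x)) @^-1` ~` [set 0]).
  apply: open_comp => [x _|]; first exact: cM.
  apply/closed_openC/accessible_closed_set1/hausdorff_accessible.
  exact: norm_hausdorff.
by apply/seteqP; split=> x /=; rewrite unitmxE unitfE => /eqP.
Qed.

Section HTuple.
Variables (C : numClosedFieldType) (H : vectType C) (dot : {dot H for conjC}).
Variable N : nat.
Implicit Types F G : htuple dot N.

(** [dot] is only conjugate linear in [G], so this is a direct estimate by the
    Cauchy-Schwarz inequality; the constant is 1 + hnorm x so that one may
    divide by it. *)
Lemma dot_coord_continuous (x : H) (j : 'I_N) :
  continuous (fun G : htuple dot N => dot x (G j)).
Proof.
move=> G; apply/(@cvgrPdist_le C C _ (nbhs G) _ _ _) => e e0 /=.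
have x0 : 0 < 1 + hnorm dot x.
  by rewrite ltr_pwDl // sqrt_dnorm_ge0.
near=> G'.
have GG' : `|G - G'| < e / (1 + hnorm dot x).
  have : ball G (e / (1 + hnorm dot x)) G'.
    by near: G'; apply: near_ball; exact: divr_gt0.
  by rewrite -ball_normE.
have -> : dot x (G j) - dot x (G' j) = dot x ((G - G') j).
  by rewrite -linearBr /htuple_fun !ffunE.
rewrite (le_trans (CauchySchwarz_sqrt dot _ _)) //.
apply: (@le_trans _ _ ((1 + hnorm dot x) * `|G - G'|)).
  apply: ler_pM; rewrite ?sqrt_dnorm_ge0 //; first by rewrite lerDr.
  exact: (htuple_norm_ub (G - G') j).
by rewrite mulrC -ler_pdivlMr // ltW.
Unshelve. all: by end_near. Qed.

Lemma htuple_lineE G G' (t : C) (j : 'I_N) :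
  htuple_fun (G + t *: (G' - G)) j = G j + t *: (G' j - G j).
Proof. by rewrite /htuple_fun !ffunE. Qed.

(** In f = \sum_j dot f (G j) *: F j the contributions of t *: G' and
    - t *: G cancel, for [t] appears conjugated in both. *)
Lemma dual_pair_line F G G' (t : C) :
  dual_pair F G -> dual_pair F G' -> dual_pair F (G + t *: (G' - G)).
Proof.
move=> dG dG' f.
have E j : dot f (htuple_fun (G + t *: (G' - G)) j) =
    dot f (G j) + t^* * (dot f (G' j) - dot f (G j)).
  by rewrite htuple_lineE linearDr linearZr_LR linearBr.
under eq_bigr do rewrite E scalerDl -scalerA scalerBl.
rewrite big_split /= -dG -scaler_sumr sumrB -dG -dG'.
by rewrite subrr scaler0 addr0.
Qed.

(** Restricting to a positive, hence real, [t] removes the conjugation and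
    makes the minor polynomial in [t]. *)
Lemma skew_gram_line F G G' (L O : {set 'I_N}) (t : C) : 0 < t ->
  skew_gram F (G + t *: (G' - G)) L O =
  skew_gram F G L O + t *: (skew_gram F G' L O - skew_gram F G L O).
Proof.
move=> t0; apply/matrixP => i j; rewrite !mxE.
rewrite htuple_lineE linearDr linearZr_LR linearBr /=.
by rewrite (conj_Creal (gtr0_real t0)).
Qed.

Lemma open_skew_minor F (L O : {set 'I_N}) (eqLO : #|O| = #|L|) :
  open [set G | castmx (erefl #|L|, eqLO) (skew_gram F G L O) \in unitmx].
Proof.
apply: open_unitmx => i j.
rewrite (_ : (fun G => _) = fun G : htuple dot N =>
  dot (F (enum_val i)) (G (enum_val (cast_ord (esym eqLO) j)))).
  exact: dot_coord_continuous.
by apply/funext => G; rewrite castmxE mxE cast_ord_id.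
Qed.

(** Moving from [G] towards a dual frame [G1] at which the minor is nonzero,
    by a step that is small and avoids the roots of the minor. *)
Lemma dense_skew_minor F (L O : {set 'I_N}) (eqLO : #|O| = #|L|) :
  full_spark F -> (#|L| <= \dim {:H})%N -> (\dim {:H} + #|L| <= N)%N ->
  O \subset (~: L)%SET ->
  dense (set_val @^-1`
    [set G | castmx (erefl #|L|, eqLO) (skew_gram F G L O) \in unitmx]
    : set (dual_set F)).
Proof.
move=> sparkF Ln nLN OL U [[G GF] UG] [V oV UV].
have dG : dual_pair F G by have := GF; rewrite inE.
have [G1 dG1 G1u] := exists_dual_unitmx eqLO sparkF Ln nLN OL.
have VG : V G by move: UG; rewrite -UV.
have [e /= e0 eV] : nbhs_ball G V.
  by apply/nbhs_ballP; exact: open_nbhs_nbhs.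
pose M (G' : htuple dot N) := castmx (erefl #|L|, eqLO) (skew_gram F G' L O).
have d0 : 0 < e / (1 + `|G1 - G|) by rewrite divr_gt0 // ltr_pwDl.
have [t [t0 te tu]] := small_unitmx (M G) G1u d0.
pose Gt := G + t *: (G1 - G).
have MGt : M Gt = M G + t *: (M G1 - M G).
  apply/matrixP => i j; rewrite /M /Gt skew_gram_line //.
  by rewrite !(castmxE, mxE).
have GtF : Gt \in dual_set F by rewrite inE; exact: dual_pair_line.
exists (exist _ Gt GtF); split; last by rewrite /= -/(M Gt) MGt.
rewrite -UV; apply: eV; rewrite -ball_normE /ball_ /=.
rewrite /Gt opprD addrA subrr sub0r normrN normrZ gtr0_norm //.
apply: le_lt_trans (_ : t * (1 + `|G1 - G|) < e).
  by rewrite ler_pM2l // lerDr.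
by rewrite -ltr_pdivlMr // ltr_pwDl.
Qed.

(** Membership in the set is the conjunction, over all pairs (L, O), of the
    conditions [A (L, O)]; a pair outside the range of the property gives the
    whole dual set. *)
Lemma generic_full_skew_spark F : full_spark F ->
  generic_in (dual_set F) [set G | dual_set F G /\ full_skew_spark F G].
Proof.
move=> hspark.
pose k : rat := Num.min (N%:R / 2%:R)
  (Num.min (\dim {:H})%:R (N%:R - (\dim {:H})%:R)).
pose A (p : {set 'I_N} * {set 'I_N}) : set (dual_set F) :=
  set_val @^-1` [set G | forall eqLO : #|p.2| = #|p.1|,
    #|p.1|%:R <= k -> p.2 \subset (~: p.1)%SET ->
    castmx (erefl #|p.1|, eqLO) (skew_gram F G p.1 p.2) \in unitmx].
have AE : set_val @^-1` [set G | dual_set F G /\ full_skew_spark F G] =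
    \bigcap_p A p :> set (dual_set F).
  apply/seteqP; split=> [G [_ sG] [L O] _ eqLO|G AG]; first exact: sG.
  split; first by have := valP G; rewrite inE.
  by move=> L O eqLO; exact: (AG (L, O) I).
have oA_dA p : open (A p) /\ dense (A p).
  case: p => L O.
  have [eqLO|neLO] := eqVneq #|O| #|L|; last first.
    rewrite (_ : A _ = setT); last first.
      by apply/seteqP; split=> // G _ /= eqLO; case/eqP: neLO.
    by split; [exact: openT|move=> U U0 _; rewrite setIT].
  have [/andP[Lk OL]|cond] := boolP ((#|L|%:R <= k) && (O \subset (~: L)%SET));
    last first.
    rewrite (_ : A _ = setT); last first.
      apply/seteqP; split=> // G _ eqLO2 /= Lk OL.
      by case/negP: cond; rewrite Lk OL.
    by split; [exact: openT|move=> U U0 _; rewrite setIT].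
  rewrite (_ : A _ = set_val @^-1`
    [set G | castmx (erefl #|L|, eqLO) (skew_gram F G L O) \in unitmx]).
    split.
      exists [set G | castmx (erefl #|L|, eqLO) (skew_gram F G L O) \in unitmx].
        exact: open_skew_minor.
      by [].
    move: Lk; rewrite /k !le_min lerBrDl -natrD !ler_nat => /and3P[_ Ln nLN].
    exact: dense_skew_minor.
  apply/seteqP; split=> G /= AG; first exact: AG.
  by move=> eqLO' _ _; rewrite (eq_irrelevance eqLO' eqLO).
have [oA dA] := open_dense_bigcap (fun p => (oA_dA p).1) (fun p => (oA_dA p).2).
by split=> [G []//||]; rewrite AE.
Qed.

End HTuple.

Theorem theorem5p7 (R : realType) (H : vectType R[i])
    (dot : {dot H for conjC}) (N : nat) (F : htuple dot N)
    (hF : is_frame F) (hspark : full_spark F) :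
  generic_in (dual_set F) [set G | dual_set F G /\ full_skew_spark F G].
Proof. exact: generic_full_skew_spark. Qed.
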